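(* Let $X$ be a Hausdorff space and let $G$ be a compact (topological) group. Then every profinite principal $G$-bundle $f\colon Y\to X$ over $X$ has a section, i.e. there is a continuous map $s\colon X\to Y$ with $f\circ s=\mathrm{id}_X$.
   Context: A topological space is profinite if it is a projective limit of finite discrete spaces. For a topological space $X$ and a compact group $G$, a profinite principal $G$-bundle over $X$ is a continuous map $f\colon Y\to X$ equipped with a free continuous group action $G\times Y\to Y$ (free: no non-trivial element of $G$ fixes a point of $Y$) such that $Y$ is profinite, $f$ is surjective, and the preimage under $f$ of each $x\in X$ is a $G$-orbit. *)

(* Defs.v *)
From HB Require Import structures.
From mathcomp Require Import all_boot all_order.
From mathcomp Require Import all_classical topology.

Set Implicit Arguments.
Unset Strict Implicit.
Unset Printing Implicit Defensive.

Local Open Scope classical_set_scope.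

(* The library only has additive (commutative) topological groups. As there,
   no separation axiom is included. *)
HB.mixin Record Group_isTopologicalGroup G of Group G & Topological G := {
  mulg_continuous : continuous (fun p : G * G => (p.1 * p.2)%g);
  invg_continuous : continuous (fun g : G => (g^-1)%g)
}.

#[short(type="topologicalGroupType")]
HB.structure Definition TopologicalGroup :=
  {G of Group G & Topological G & Group_isTopologicalGroup G}.

Record inverse_system d (I : preorderType d) := InverseSystem {
  obj :> I -> topologicalType;
  bond : forall i j : I, (i <= j)%O -> obj j -> obj i;
  bond_continuous : forall (i j : I) (ij : (i <= j)%O), continuous (bond ij);
  bond_id : forall (i : I) (ii : (i <= i)%O) (x : obj i), bond ii x = x;
  bond_comp : forall (i j k : I) (ij : (i <= j)%O) (jk : (j <= k)%O)
    (ik : (i <= k)%O) (x : obj k), bond ij (bond jk x) = bond ik x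
}.

Definition threads d (I : preorderType d) (S : inverse_system I) :
    set (prod_topology (fun i => S i)) :=
  [set x | forall (i j : I) (ij : (i <= j)%O), bond ij (x j) = x i].
Arguments threads {d I} S.

(* [set_type] carries the topology induced by the product topology. *)
Definition projective_limit d (I : preorderType d) (S : inverse_system I) :
    topologicalType :=
  set_type (threads S).

Definition directed d (I : preorderType d) : Prop :=
  (exists i : I, True) /\
  (forall i j : I, exists k : I, (i <= k)%O /\ (j <= k)%O).

Definition homeomorphic (Y Z : topologicalType) : Prop :=
  exists (h : Y -> Z) (k : Z -> Y),
    [/\ continuous h, continuous k, cancel h k & cancel k h].

Definition profinite (Y : topologicalType) : Prop :=
  exists (d : Order.disp_t) (I : preorderType d) (S : inverse_system I),
    [/\ directed I,
        forall i, finite_set [set: S i],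
        forall i (A : set (S i)), open A
      & homeomorphic Y (projective_limit S)].

Record continuous_action (G : topologicalGroupType) (Y : topologicalType)
    (act : G -> Y -> Y) : Prop := {
  act1 : forall y, act 1%g y = y;
  actM : forall g h y, act (g * h)%g y = act g (act h y);
  act_continuous : continuous (fun p : G * Y => act p.1 p.2)
}.

Definition free_action (G : topologicalGroupType) (Y : topologicalType)
    (act : G -> Y -> Y) : Prop :=
  forall (g : G) (y : Y), act g y = y -> g = 1%g.

Record profinite_principal_bundle (G : topologicalGroupType)
    (X Y : topologicalType) (f : Y -> X) (act : G -> Y -> Y) : Prop := {
  bundle_continuous : continuous f;
  bundle_action : continuous_action act;
  bundle_free : free_action act;
  bundle_profinite : profinite Y;
  bundle_surjective : forall x, exists y, f y = x;
  bundle_fibre : forall x, exists y, f @^-1` [set x] = range (act^~ y)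
}.

(* Main.v *)
(* By Zorn, there is a minimal closed T in Y which surjects onto X and meets
   each fibre in an orbit of one closed subgroup H of G. If H contained h <> 1,
   choose a clopen K with y in K and h y outside K: its stabilizer U is a clopen
   subgroup of G missing h, and T can be cut down to U `&` H, because it is
   covered by clopen U-invariant sets that meet each fibre in at most one
   U-orbit; finitely many suffice and they can be glued over clopen pieces of X.
   Hence H = 1, so f restricts to a continuous bijection from the compact T to
   the Hausdorff X, and the inverse of that bijection is the section. *)
Require Import Defs.
From mathcomp Require Import all_boot all_order.
From mathcomp Require Import all_classical topology.
Local Open Scope classical_set_scope.

(** * Compactness and the topology of profinite spaces *)

Lemma compact_set_type (X : topologicalType) (A : set X) :
  compact A -> compact [set: set_type A].
Proof.
move=> cA F PF _; have [|p [Ap clp]] := cA (set_val @ F).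
  by apply: (@filterE _ F) => x; exact: set_valP.
exists (exist _ p (mem_set Ap)); split=> // B N FB.
rewrite nbhsE => -[_ [[O oO <-] Op] ON].
have [] := clp (set_val @` B) O.
- by apply: (@filterS _ F _ B) FB => x Bx; exists x.
- exact: open_nbhs_nbhs.
by move=> _ [[x Bx <-] Ox]; exists x; split => //; exact: ON.
Qed.

Section Profinite.
Context {Y : topologicalType} (hY : profinite Y).

(** Distinct threads differ at some index, and the level there is discrete, so prescribing that
    coordinate is a clopen condition. *)
Lemma profinite_zero_dimensional : zero_dimensional Y.
Proof.
case: hY => d [I [S [_ _ opS [h [k [ch _ hK _]]]]]] y z yz.
have [i nei] : exists i, set_val (h y) i <> set_val (h z) i.
  apply/existsNP => eqi; move/eqP: yz; apply; apply: (can_inj hK).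
  by apply: val_inj; exact: (functional_extensionality_dep eqi).
have cv : continuous
    (set_val : projective_limit S -> prod_topology (fun i => S i)).
  exact: initial_continuous.
pose p : projective_limit S -> S i := proj i \o set_val.
have cp : continuous (p \o h).
  move=> w; apply: continuous_comp; first exact: ch.
  exact: (@continuous_comp _ (prod_topology (fun i => S i)) _ set_val (proj i)
    (h w) (@cv _) (@proj_continuous _ _ i _)).
exists ((p \o h) @^-1` [set p (h y)]); split=> //; last by move=> /esym.
apply: preimage_clopen cp; split; first exact: opS.
by rewrite -openC; exact: opS.
Qed.

Lemma profinite_compact : compact [set: Y].
Proof.
case: hY => d [I [S [_ finS opS [h [k [_ ck hK _]]]]]].
have cS : compact (threads S).
  have cP : compact [set: prod_topology (fun i => S i)].
    have := @tychonoff _ (fun i => S i) (fun i => setT)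
      (fun i => finite_compact (finS i)).
    by congr compact; apply/seteqP; split.
  (* Fixing the coordinates [i] and [j] of a limit point is an open condition, so some thread shares
     both and passes its bond equation on. *)
  apply: subclosed_compact cP _ => // x clx i j ij.
  have nbhs_eq (l : I) :
      nbhs x [set z : prod_topology (fun i => S i) | z l = x l].
    apply: (@proj_continuous _ _ l x [set x l]).
    by apply: open_nbhs_nbhs; split => //; exact: opS.
  have [z [zS [/= zi zj]]] := clx _ (filterI (nbhs_eq i) (nbhs_eq j)).
  by rewrite -zi -zj; exact: zS.
have -> : [set: Y] = k @` [set: projective_limit S].
  by apply/seteqP; split=> // y _; exists (h y).
apply: continuous_compact; last exact: compact_set_type.
by apply: continuous_subspaceT.
Qed.

Lemma profinite_hausdorff : hausdorff_space Y.
Proof.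
move=> y z clyz; apply: contrapT => /eqP/profinite_zero_dimensional.
move=> [U [[oU cU] Uy nUz]].
have [] := clyz U (~` U); [exact: open_nbhs_nbhs| |by move=> w []].
by apply: open_nbhs_nbhs; split => //; exact: closed_openC.
Qed.

Lemma profinite_clopen_nbhs (y : Y) (N : set Y) :
  nbhs y N -> exists C, [/\ clopen C, C y & C `<=` N].
Proof.
move=> /(zero_dimensional_cvg profinite_hausdorff profinite_zero_dimensional
  profinite_compact)[C [Cy clC] CN].
by exists C.
Qed.

End Profinite.

(** By directedness the indices beyond a given one form a filter base; near-covering compactness
    along this filter yields one index good for all of [K]. *)
Lemma compact_directed_cover {X : topologicalType} {I : Type} (K : set X)
    (D : set I) (O : I -> set X) :
  compact K -> D !=set0 -> (forall i, D i -> open (O i)) ->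
  (forall i j, D i -> D j ->
     exists k, [/\ D k, O i `<=` O k & O j `<=` O k]) ->
  K `<=` \bigcup_(i in D) O i -> exists2 i, D i & K `<=` O i.
Proof.
move=> /compact_near_coveringP cK D0 oO dir cov.
pose F := filter_from D (fun i => [set j | D j /\ O i `<=` O j]).
have FF : Filter F.
  apply: filter_from_filter => // i j Di Dj.
  have [k [Dk ik jk]] := dir _ _ Di Dj; exists k => // l [Dl kl].
  by split; split=> //; apply: subset_trans kl.
have [x Kx|i Di iK] := cK I F O FF.
  have [i Di Oix] := cov _ Kx.
  exists (O i, [set j | D j /\ O i `<=` O j]).
    split; last by exists i.
    by apply: open_nbhs_nbhs; split => //; exact: oO.
  by move=> [z j] [/= Oz [_]]; apply.
by exists i => //; apply: iK; split.
Qed.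

(** * Clopen subgroups and the clopen sets invariant under them *)

Section ClopenSubgroup.
Context {G : topologicalGroupType} {Y : topologicalType} {act : G -> Y -> Y}.
Hypotheses (hact : continuous_action act) (cY : compact [set: Y]).

Lemma act_translation_continuous (g : G) : continuous (act g).
Proof.
move=> y; apply: (@continuous_comp _ (G * Y)%type _ (fun z => (g, z))
  (fun p => act p.1 p.2)); last exact: act_continuous.
by apply: cvg_pair; [exact: cvg_cst | exact: cvg_id].
Qed.

Lemma actVK (g : G) : cancel (act g) (act g^-1%g).
Proof. by move=> y; rewrite -(actM hact) mulVg (act1 hact). Qed.

Lemma actKV (g : G) : cancel (act g^-1%g) (act g).
Proof. by move=> y; rewrite -(actM hact) mulgV (act1 hact). Qed.

Definition set_stabilizer (K : set Y) : set G :=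
  [set g | forall y, K y <-> K (act g y)].

Lemma set_stabilizerM (K : set Y) (g h : G) :
  set_stabilizer K g -> set_stabilizer K h -> set_stabilizer K (g * h)%g.
Proof. by move=> Kg Kh y; rewrite (actM hact); rewrite (Kh y); exact: Kg. Qed.

Lemma set_stabilizerV (K : set Y) (g : G) :
  set_stabilizer K g -> set_stabilizer K g^-1%g.
Proof. by move=> Kg y; rewrite -{1}[y](actKV g) -Kg. Qed.

Lemma clopen_agree (K : set Y) :
  clopen K -> clopen [set p : G * Y | K p.2 <-> K (act p.1 p.2)].
Proof.
move=> clK; rewrite (_ : mkset _ =
    (snd @^-1` K `&` (fun p => act p.1 p.2) @^-1` K) `|`
    (snd @^-1` (~` K) `&` (fun p => act p.1 p.2) @^-1` (~` K))).
  have clA B : clopen B -> clopen ((fun p : G * Y => act p.1 p.2) @^-1` B).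
    by move=> clB; exact: (preimage_clopen clB (act_continuous hact)).
  have cl2 B : clopen B -> clopen ((snd : G * Y -> Y) @^-1` B).
    by move=> clB; apply: preimage_clopen => // p; exact: cvg_snd.
  by apply: clopenU; apply: clopenI;
    [exact: cl2|exact: clA|apply: cl2|apply: clA]; apply: clopenC.
apply/seteqP; split=> -[g y] /=; last by move=> [[]|[]].
by have [Ky|nKy] := pselect (K y); [left; tauto | right; tauto].
Qed.

(** Openness is a tube argument: agreement is open in the pair, and compactness of [Y] makes it
    uniform in the point. Closedness comes from intersecting over all points. *)
Lemma clopen_set_stabilizer (K : set Y) : clopen K -> clopen (set_stabilizer K).
Proof.
move=> /clopen_agree[oA cA]; split.
  rewrite openE => g Kg; rewrite /interior.
  apply: (@filterS _ _ _
    [set h | [set: Y] `<=` (fun y => K y <-> K (act h y))]).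
    by move=> h Kh y; exact: Kh.
  apply: (iffLR (compact_near_coveringP _) cY) => y _.
  have [[M N] [gM yN] MN] :
      nbhs (g, y) [set p : G * Y | K p.2 <-> K (act p.1 p.2)].
    by apply: open_nbhs_nbhs; split => //; exact: Kg.
  by exists (N, M) => //= -[z h] [/= Nz Mh]; exact: (MN (h, z)).
rewrite (_ : set_stabilizer K = \bigcap_(y in [set: Y])
    (fun g => (g, y)) @^-1` [set p : G * Y | K p.2 <-> K (act p.1 p.2)]).
  apply: closed_bigI => y _.
  apply: (iffLR (continuous_closedP _)) cA => g.
  by apply: cvg_pair; [exact: cvg_id | exact: cvg_cst].
by apply/seteqP; split=> g /= Kg y; [move=> _; exact: Kg | exact: (Kg y)].
Qed.

(** By freeness and compactness of the complement of [U], some clopen [W] around [y] is disjoint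
    from its translates by all [g] outside [U]. The saturation of [W] under [U] is the required
    set. *)
Lemma clopen_invariant_nbhs (U : set G) (y : Y) :
  zero_dimensional Y -> hausdorff_space Y -> compact [set: G] ->
  free_action act -> clopen U -> U 1%g ->
  (forall g h, U g -> U h -> U (g * h)%g) -> (forall g, U g -> U g^-1%g) ->
  exists C, [/\ clopen C, C y, forall u z, U u -> C z -> C (act u z)
    & forall g z, C z -> C (act g z) -> U g].
Proof.
move=> zY hY cG free [oU cU] U1 UM UV.
pose D := [set W : set Y | clopen W /\ W y].
pose O (W : set Y) := [set p : G * Y | ~ (W p.2 /\ W (act p.1 p.2))].
have [||W [[oW cW] Wy]|W1 W2 [cl1 W1y] [cl2 W2y]||W [[oW cW] Wy] WO] :=
  @compact_directed_cover _ _ (~` U `*` [set: Y]) D O.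
- apply: compact_setX => //; apply: subclosed_compact cG _ => //.
  exact: open_closedC.
- by exists setT; split => //; exact: clopenT.
- rewrite (_ : O W = ~` ((snd : G * Y -> Y) @^-1` W `&`
                         (fun p => act p.1 p.2) @^-1` W)) //.
  apply: closed_openC; apply: closedI.
    by apply: (iffLR (continuous_closedP _)) cW => p; exact: cvg_snd.
  exact: (iffLR (continuous_closedP _) (act_continuous hact)).
- exists (W1 `&` W2); split; first by split; [exact: clopenI|].
    by move=> p /= + [[? _] [? _]]; apply.
  by move=> p /= + [[_ ?] [_ ?]]; apply.
- move=> [g w] [/= nUg _].
  have [wy|/eqP/zY[W [clW Wy nWw]]] := pselect (y = w); last first.
    by exists W => //= -[].
  have /eqP/zY[W [clW Wy nWw]] : y <> act g w.
    by rewrite -wy => /esym/free g1; apply: nUg; rewrite g1.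
  by exists W => //= -[].
have WU g w : W w -> W (act g w) -> U g.
  by move=> Ww Wgw; apply: contrapT => nUg; apply: (WO (g, w)).
(* The saturation is open as a union of translates of [W], and closed as the image of the compact
   product of [U] and [W]. *)
exists [set z | exists2 u, U u & W (act u z)]; split.
- split.
    rewrite (_ : mkset _ = \bigcup_(u in U) (act u @^-1` W)).
      apply: bigcup_open => u _; apply: open_comp => // z _.
      exact: act_translation_continuous.
    by apply/seteqP; split=> z [u Uu Wz]; exists u.
  rewrite (_ : mkset _ = (fun p => act p.1 p.2) @` (U `*` W)).
    apply: compact_closed => //; apply: continuous_compact.
      by apply: continuous_subspaceT; exact: act_continuous.
    by apply: compact_setX; [apply: subclosed_compact cG _
                            |apply: subclosed_compact cY _].
  apply/seteqP; split=> [z [u Uu Wz]|_ [[u z] [/= Uu Wz] <-]].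
    by exists (u^-1%g, act u z); [split=> //; exact: UV|exact: actVK].
  by exists u^-1%g; [exact: UV|rewrite actVK].
- by exists 1%g => //; rewrite (act1 hact).
- move=> u z Uu [v Uv Wz]; exists (v * u^-1)%g.
    by apply: UM => //; exact: UV.
  by rewrite (actM hact) actVK.
- move=> g z [u Uu Wz] [v Uv Wgz].
  (* This element moves one point of [W] to another; cancelling [v] and [u^-1] inside [U] isolates
     [g]. *)
  have : U (v * g * u^-1)%g.
    by apply: (WU _ _ Wz); rewrite 2!(actM hact) actVK.
  move=> /(UM _ _ (UV _ Uv)) /UM /(_ Uu).
  by rewrite !mulgA mulVg mul1g -mulgA mulVg mulg1.
Qed.

End ClopenSubgroup.

(** * Reductions of the structure group: refinement and minimality *)

Section Reduction.
Context {X : topologicalType} {G : topologicalGroupType} {Y : topologicalType}.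
Context {f : Y -> X} {act : G -> Y -> Y}.
Hypotheses (hX : hausdorff_space X) (hG : compact [set: G]).
Hypothesis hf : profinite_principal_bundle f act.

Let hact : continuous_action act := bundle_action hf.
Let cf : continuous f := bundle_continuous hf.
Let cY : compact [set: Y] := profinite_compact (bundle_profinite hf).

Lemma bundle_same_fibre (y z : Y) : f y = f z -> exists g, z = act g y.
Proof.
have [w fw] := bundle_fibre hf (f y) => fyz.
have [g _ gy] : range (act^~ w) y by rewrite -fw.
have [h _ hz] : range (act^~ w) z by rewrite -fw /= -fyz.
by exists (h * g^-1)%g; rewrite -gy -hz (actM hact) (actVK hact).
Qed.

Lemma bundle_act (g : G) (y : Y) : f (act g y) = f y.
Proof.
have [w fw] := bundle_fibre hf (f y).
have [h _ hy] : range (act^~ w) y by rewrite -fw.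
have : range (act^~ w) (act g y).
  by exists (g * h)%g => //; rewrite (actM hact) -hy.
by rewrite -fw.
Qed.

Lemma bundle_closed_image (A : set Y) : closed A -> closed (f @` A).
Proof.
move=> cA; apply: compact_closed => //; apply: continuous_compact.
  exact: continuous_subspaceT.
exact: subclosed_compact cY _.
Qed.

Lemma bundle_compact_fibre (x : X) : compact (f @^-1` [set x]).
Proof.
apply: subclosed_compact cY _ => //.
apply: (iffLR (continuous_closedP _) cf); apply: compact_closed => //.
exact: compact_set1.
Qed.

(* Closed reductions of the structure group: T meets each fibre in an orbit of
   the closed subgroup {g | g T = T}, which the last clause describes without
   mentioning it. *)
Definition reduction (T : set Y) : Prop :=
  [/\ closed T, f @` T = [set: X] &
      forall g t t', T t -> T (act g t) -> T t' -> T (act g t')].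

(* T -> X is a quotient by the group H of T, so it is enough that the
   saturation of [T `&` C] under H is open in T. *)
Lemma reduction_open_image (T C : set Y) :
  reduction T -> open C -> open (f @` (T `&` C)).
Proof.
move=> [cT fT Tact] oC.
pose H := [set g | forall t, T t -> T (act g t)].
pose HC := \bigcup_(h in H) (act h @^-1` C).
have oHC : open HC.
  apply: bigcup_open => h _; apply: open_comp => // y _.
  exact: act_translation_continuous.
(* Points of [T] in one fibre differ by an element of [H], so a fibre that meets [T] and [C]
   together has all its points of [T] in [HC]. *)
rewrite (_ : f @` (T `&` C) = ~` (f @` (T `&` ~` HC))).
  apply: closed_openC; apply: bundle_closed_image; apply: closedI => //.
  exact: open_closedC.
apply/seteqP; split=> [_ [c [Tc Cc] <-] [t [Tt nHCt]]|x nx].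
  move=> /bundle_same_fibre[g cgt]; apply: nHCt; exists g.
    by move=> t' Tt'; apply: Tact Tt' => //; [exact: Tt|rewrite -cgt].
  by rewrite /= -cgt.
have [t Tt ftx] : (f @` T) x by rewrite fT.
have [h Hh Cht] : HC t by apply: contrapT => nHC; apply: nx; exists t.
by exists (act h t); [split=> //; exact: Hh|rewrite bundle_act].
Qed.

(** Partial refinements exist near each point of [X] and can be glued in pairs, so compactness of
    [X] provides one defined everywhere. *)
Lemma reduction_refine (T : set Y) (U : set G) :
  reduction T -> clopen U -> U 1%g ->
  (forall g h, U g -> U h -> U (g * h)%g) -> (forall g, U g -> U g^-1%g) ->
  exists S, [/\ reduction S, S `<=` T &
    forall g s, S s -> S (act g s) -> U g].
Proof.
move=> rT clU U1 UM UV; have [cT fT Tact] := rT.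
have pY := bundle_profinite hf.
(* Partial refinements, defined over the open part f(S) of X. *)
pose D := [set S : set Y | [/\ closed S, S `<=` T, open (f @` S),
  forall u s, U u -> S s -> T (act u s) -> S (act u s) &
  forall g s, S s -> S (act g s) -> U g]].
have loc (C : set Y) : clopen C -> (forall u z, U u -> C z -> C (act u z)) ->
    (forall g z, C z -> C (act g z) -> U g) -> D (T `&` C).
  move=> [oC cC] CU CS; split.
  - exact: closedI.
  - by move=> y [].
  - exact: reduction_open_image.
  - by move=> u s Uu [Ts Cs] Tus; split=> //; exact: CU.
  - by move=> g s [_ Cs] [_ Cgs]; exact: CS Cgs.
have [||S [_ _ oS _ _]|S1 S2 D1 D2|x _|S [cS ST oS SU SG] XS] :=
  @compact_directed_cover X _ [set: X] D (fun S => f @` S).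
- have -> : [set: X] = f @` [set: Y].
    apply/seteqP; split=> // x _.
    by have [y <-] := bundle_surjective hf x; exists y.
  by apply: continuous_compact => //; exact: continuous_subspaceT.
- exists (T `&` set0); apply: loc => //; exact: clopen0.
- by [].
- have [cS1 S1T oS1 S1U S1G] := D1; have [cS2 S2T oS2 S2U S2G] := D2.
  (* [S1] is kept over its image and [S2] is used elsewhere. Openness of the image of [S1] keeps the
     second piece closed, and no fibre meets both pieces. *)
  exists (S1 `|` S2 `&` f @^-1` (~` (f @` S1))).
  have fS : f @` (S1 `|` S2 `&` f @^-1` (~` (f @` S1))) = f @` S1 `|` f @` S2.
    apply/seteqP; split=> [x [y [S1y|[S2y _]] <-]|x].
    - by left; exists y.
    - by right; exists y.
    - have [S1x|nS1x] := pselect ((f @` S1) x).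
        by move=> _; have [y S1y <-] := S1x; exists y => //; left.
      case=> // -[y S2y fy]; exists y => //; right; split => //.
      by rewrite /= fy.
  split; rewrite ?fS; [split|by left|by right].
  - apply: closedU => //; apply: closedI => //.
    by apply: (iffLR (continuous_closedP _) cf); exact: open_closedC.
  - by move=> y [/S1T|[/S2T]].
  - by rewrite fS; exact: openU.
  - move=> u s Uu [S1s|[S2s ns]] Tus; first by left; exact: S1U.
    by right; split; [exact: S2U|rewrite /preimage /= bundle_act].
  - move=> g s [S1s|[S2s ns]] [S1g|[S2g ng]].
    + exact: S1G S1g.
    + by case: ng; exists s => //; rewrite bundle_act.
    + by case: ns; exists (act g s) => //; rewrite bundle_act.
    + exact: S2G S2g.
- have [t Tt ftx] : (f @` T) x by rewrite fT.
  have [C [clC Ct CU CG]] := clopen_invariant_nbhs hact cY U t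
    (profinite_zero_dimensional pY) (profinite_hausdorff pY) hG
    (bundle_free hf) clU U1 UM UV.
  by exists (T `&` C); [exact: loc|exists t].
- exists S; split=> //; split=> //; first by apply/seteqP; split.
  move=> g s s' Ss Sgs Ss'; apply: SU => //; first exact: SG Sgs.
  by apply: (Tact g s); exact: ST.
Qed.

(** Zorn is applied to complements, which turns intersections of chains of reductions into
    unions. *)
Lemma minimal_reduction :
  exists T, reduction T /\ forall S, reduction S -> S `<=` T -> S = T.
Proof.
have [|A [rA minA]] := @Zorn_bigcup _ [set A | reduction (~` A)].
  move=> F FR totF; split.
  - apply: open_closedC; apply: bigcup_open => A /FR[/closed_openC].
    by rewrite setCK.
  (* If the intersection missed the fibre over [x], the complements would cover this compact fibre,
     so a single one would, against surjectivity of its reduction. *)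
  - apply/seteqP; split=> // x _; apply: contrapT => nx.
    have cov : f @^-1` [set x] `<=` \bigcup_(A in F) A.
      by move=> y fy; apply: contrapT => nFy; apply: nx; exists y.
    have [|A FA|A B FA FB|A FA xA] :=
        compact_directed_cover _ _ id (bundle_compact_fibre x) _ _ _ cov.
    + have [y /cov[A FA _]] := bundle_surjective hf x.
      by exists A.
    + by have [/closed_openC + _ _] := FR _ FA; rewrite setCK.
    + by have [AB|BA] := totF _ _ FA FB; [exists B; split|exists A; split].
    + have [_ fA _] := FR _ FA.
      have [y nAy fy] : (f @` ~` A) x by rewrite fA.
      by apply: nAy; exact: xA.
  - move=> g t t' nt ngt nt' [A FA Agt]; have [_ _ rA] := FR _ FA.
    apply: (rA g t t') Agt => At; [apply: nt|apply: ngt|apply: nt'];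
      by exists A.
exists (~` A); split=> // S rS SA; apply: contrapT => neSA.
apply: (minA (~` S)); last by rewrite /= setCK.
rewrite properEneq; split; last exact: subsetCr.
by apply/eqP => AS; apply: neSA; rewrite AS setCK.
Qed.

(** Refining by the stabilizer of a [K] that separates [y] from [z] leaves [T] unchanged by
    minimality, so the element moving [y] to [z] preserves [K], a contradiction. *)
Lemma minimal_reduction_trivial (T : set Y) :
  reduction T -> (forall S, reduction S -> S `<=` T -> S = T) ->
  forall y z, T y -> T z -> f y = f z -> y = z.
Proof.
move=> rT minT y z Ty Tz /bundle_same_fibre[h zhy].
apply: contrapT => /eqP/(profinite_zero_dimensional (bundle_profinite hf)).
move=> [K [clK Ky nKz]].
have [||||S [rS ST SK]] := @reduction_refine T (set_stabilizer (act:=act) K) rT.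
- exact: clopen_set_stabilizer.
- by move=> w; rewrite (act1 hact).
- exact: set_stabilizerM.
- exact: set_stabilizerV.
have ES := minT S rS ST.
have Kh : set_stabilizer (act:=act) K h by apply: (SK _ y); rewrite ES -?zhy.
by apply: nKz; rewrite zhy -(Kh y).
Qed.

End Reduction.

Theorem theorem4p7 (X : topologicalType) (G : topologicalGroupType)
    (hX : hausdorff_space X) (hG : compact [set: G])
    (Y : topologicalType) (f : Y -> X) (act : G -> Y -> Y)
    (hf : profinite_principal_bundle f act) :
  exists s : X -> Y, continuous s /\ f \o s = id.
Proof.
have [T [rT minT]] := minimal_reduction hX hf.
have Tinj := minimal_reduction_trivial hX hG hf T rT minT.
have [cT fT _] := rT.
have /choice[s sP] : forall x, exists y, T y /\ f y = x.
  by move=> x; have [y Ty fy] : (f @` T) x by [rewrite fT]; exists y.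
exists s; split; last by apply/funext => x; case: (sP x).
apply/continuous_closedP => B cB.
(* Injectivity of [f] on [T] turns the preimage into an image, which is closed because [f] is a
   closed map. *)
rewrite (_ : s @^-1` B = f @` (T `&` B)).
  by apply: (bundle_closed_image hX hf); exact: closedI.
apply/seteqP; split=> [x Bx|_ [y [Ty By] <-]].
  by have [Tsx fsx] := sP x; exists (s x).
have [Tsy fsy] := sP (f y).
by rewrite /= (Tinj _ _ Tsy Ty fsy).
Qed.
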